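(* Let $M$ be a smooth manifold and let $g,\tilde g$ be two almost compatible (pseudo-Riemannian) metrics on $M$, and let $\circ$ be the multiplication on $T^*M$ defined by $\alpha\circ\beta:=\nabla_{g^*\alpha}\beta-\tilde\nabla_{g^*\alpha}\beta$. Then $g$ and $\tilde g$ are compatible if and only if $$(\beta\circ\gamma)\circ\alpha=(\beta\circ\alpha)\circ\gamma$$ for every $\alpha,\beta,\gamma\in\mathcal{E}^{1}(M)$.
   Context: $\mathcal{X}(M)$ denotes the smooth vector fields and $\mathcal{E}^1(M)$ the smooth $1$-forms on $M$. ''Metric'' means pseudo-Riemannian metric. For a metric $g$, $g^*$ denotes the induced metric on $T^*M$; also $g(X)$ denotes the $1$-form $g(X,\cdot)$ and $g^*\alpha$ the vector field corresponding to the $1$-form $\alpha$ under $TM\cong T^*M$. Levi-Civita connections $\nabla$ of $g$ and $\tilde\nabla$ of $\tilde g$ are also used for the induced connections on $T^*M$; $R,\tilde R$ are the curvatures, $R_{X,Y}=\nabla_X\nabla_Y-\nabla_Y\nabla_X-\nabla_{[X,Y]}$ (acting here on $1$-forms). For every constant $\lambda$ put $g_\lambda^*:=g^*+\lambda\tilde g^*$; it is a standing assumption that $g_\lambda^*$ is non-degenerate for every constant $\lambda$. $g_\lambda$ is the corresponding metric, with Levi-Civita connection $\nabla^\lambda$ and curvature $R^\lambda$. $g,\tilde g$ are almost compatible if $g_\lambda^*\nabla^\lambda_X\alpha=g^*\nabla_X\alpha+\lambda\tilde g^*\tilde\nabla_X\alpha$ for all $X\in\mathcal{X}(M)$, $\alpha\in\mathcal{E}^1(M)$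 and constants $\lambda$. They are compatible if they are almost compatible and moreover $g_\lambda^*(R^\lambda_{X,Y}\alpha)=g^*(R_{X,Y}\alpha)+\lambda\tilde g^*(\tilde R_{X,Y}\alpha)$ for all $\alpha\in\mathcal{E}^1(M)$, $X,Y\in\mathcal{X}(M)$ and constants $\lambda$. *)

(* Defs.v *)
From HB Require Import structures.
From mathcomp Require Import all_boot all_order all_algebra.
From mathcomp Require Import all_classical all_reals all_analysis.
From mathcomp Require Import ring.

Set Implicit Arguments.
Unset Strict Implicit.
Unset Printing Implicit Defensive.

Import Order.TTheory GRing.Theory Num.Theory numFieldNormedType.Exports.

Local Open Scope classical_set_scope.
Local Open Scope ring_scope.

Section SmoothOn.
Context {R : realType} {n : nat}.
Implicit Types (U : set 'rV[R]_n) (f g : 'rV[R]_n -> R) (x : 'rV[R]_n).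

Definition along i f x : R -> R := fun t => f (x + t *: delta_mx 0 i).

Definition partial i f x : R := 'D_1 (along i f x) 0.

(* f has continuous partial derivatives of all orders <= k on the open set U. *)
Fixpoint Ck k U f : Prop :=
  (forall x, U x -> {for x, continuous f}) /\
  (if k is k'.+1 then
     forall i, (forall x, U x -> derivable (along i f x) 0 1) /\
               Ck k' U (partial i f)
   else True).

Definition smooth_on U f := forall k, Ck k U f.

Lemma along0 i f x : along i f x 0 = f x.
Proof. by rewrite /along scale0r addr0. Qed.

Lemma CkS k U f : Ck k.+1 U f -> Ck k U f.
Proof.
elim: k f => [|k IH] f [cf df]; split=> // i.
by have [dfi Cfi] := df i; split=> //; exact: IH.
Qed.

Lemma near_along i x (A : set 'rV[R]_n) :
  nbhs x A -> \forall t \near (0 : R), A (x + t *: delta_mx 0 i).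
Proof.
move=> [P xP PA]; suff : \forall t \near (0 : R),
    forall j k, P j k ((x + t *: delta_mx 0 i) j k).
  by apply: (@filterS R (nbhs (0 : R)) _) => t Pt; exact: PA.
apply: (@filter_forall R _ (fun j t => forall k, P j k ((x + t *: delta_mx 0 i) j k)) (nbhs (0 : R)) _) => j.
apply: (@filter_forall R _ (fun k t => P j k ((x + t *: delta_mx 0 i) j k)) (nbhs (0 : R)) _) => k.
have : ((fun t : R => x j k + t * ((j == 0) && (k == i))%:R) @ 0)
       --> x j k + 0 * ((j == 0) && (k == i))%:R.
  by apply: cvgD; [exact: cvg_cst|apply: cvgM; [exact: cvg_id|exact: cvg_cst]].
rewrite mul0r addr0 => /(_ _ (xP j k)).
by apply: (@filterS R (nbhs (0 : R)) _) => t; rewrite !mxE.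
Qed.

Lemma near_eq_along U i f g x : open U -> U x -> (forall y, U y -> f y = g y) ->
  \forall t \near (0 : R), along i f x t = along i g x t.
Proof.
move=> Uo Ux fg; have : nbhs x U by exact: open_nbhs_nbhs.
by move/(near_along i); apply: (@filterS R (nbhs (0 : R)) _) => t /fg.
Qed.

Lemma continuous_eq_on U f g x : open U -> (forall y, U y -> f y = g y) ->
  U x -> {for x, continuous f} -> {for x, continuous g}.
Proof.
move=> Uo fg Ux cf; suff : g @ x --> g x by [].
rewrite -fg//; apply: cvg_trans cf; apply: (@near_eq_cvg _ _ (nbhs x) _ f g).
have : nbhs x U by exact: open_nbhs_nbhs.
by apply: (@filterS _ (nbhs x) _) => y /fg.
Qed.

Lemma Ck_eq k U f g : open U -> (forall x, U x -> f x = g x) ->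
  Ck k U f -> Ck k U g.
Proof.
move=> Uo; elim: k f g => [|k IH] f g fg [cf df]; split=> //.
- by move=> x Ux; exact: continuous_eq_on fg Ux (cf x Ux).
- by move=> x Ux; exact: continuous_eq_on fg Ux (cf x Ux).
move=> i; have [dfi Cfi] := df i; split=> [x Ux|].
  have := near_eq_along i Uo Ux fg => /near_eq_derivable; apply.
  exact: dfi.
apply: IH Cfi => x Ux; rewrite /partial.
by apply: near_eq_derive; exact: near_eq_along Ux fg.
Qed.

Lemma Ck_cst k U (a : R) : open U -> Ck k U (fun=> a).
Proof.
move=> Uo; elim: k a => [|k IH] a; split=> //.
- by move=> x _; exact: cst_continuous.
- by move=> x _; exact: cst_continuous.
move=> i; split=> [x _|]; first exact: (@derivable_cst _ _ _ a).
apply: (@Ck_eq k U (fun=> 0)) => // x _.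
by rewrite /partial (_ : along i _ x = cst a)// derive_cst.
Qed.

Lemma CkD k U f g : open U -> Ck k U f -> Ck k U g -> Ck k U (f \+ g).
Proof.
move=> Uo; elim: k f g => [|k IH] f g [cf df] [cg dg]; split=> //.
- by move=> x Ux; exact: (@cvgD _ _ _ (nbhs x) _ f g _ _ (cf x Ux) (cg x Ux)).
- by move=> x Ux; exact: (@cvgD _ _ _ (nbhs x) _ f g _ _ (cf x Ux) (cg x Ux)).
move=> i; have [dfi Cfi] := df i; have [dgi Cgi] := dg i; split=> [x Ux|].
  by apply: (@derivableD _ _ _ (along i f x) (along i g x)); [exact: dfi|exact: dgi].
apply: (@Ck_eq k U (partial i f \+ partial i g)) => //; last exact: IH.
move=> x Ux; rewrite /partial /=.
by rewrite -(deriveD (dfi x Ux) (dgi x Ux)).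
Qed.

Lemma CkM k U f g : open U -> Ck k U f -> Ck k U g -> Ck k U (f \* g).
Proof.
move=> Uo; elim: k f g => [|k IH] f g Cf Cg.
  have [cf _] := Cf; have [cg _] := Cg.
  by split=> // x Ux; exact: (@cvgM _ _ (nbhs x) _ f g _ _ (cf x Ux) (cg x Ux)).
have [cf df] := Cf; have [cg dg] := Cg; split.
  by move=> x Ux; exact: (@cvgM _ _ (nbhs x) _ f g _ _ (cf x Ux) (cg x Ux)).
move=> i; have [dfi Cfi] := df i; have [dgi Cgi] := dg i; split=> [x Ux|].
  by apply: (@derivableM _ _ (along i f x) (along i g x)); [exact: dfi|exact: dgi].
apply: (@Ck_eq k U ((f \* partial i g) \+ (g \* partial i f))) => //.
  move=> x Ux; rewrite /partial /=.
  rewrite (_ : along i (f \* g) x = along i f x * along i g x)//.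
  by rewrite (deriveM (dfi x Ux) (dgi x Ux)) !along0.
by apply: CkD => //; apply: IH => //; exact: CkS.
Qed.

End SmoothOn.

Record chart (R : realType) (n : nat) (M : topologicalType) := Chart {
  chart_dom : set M;
  chart_cod : set 'rV[R]_n;
  chart_map : M -> 'rV[R]_n;
  chart_inv : 'rV[R]_n -> M;
  chart_open_dom : open chart_dom;
  chart_open_cod : open chart_cod;
  chart_mapP : forall p, chart_dom p -> chart_cod (chart_map p);
  chart_invP : forall x, chart_cod x -> chart_dom (chart_inv x);
  chart_mapK : forall p, chart_dom p -> chart_inv (chart_map p) = p;
  chart_invK : forall x, chart_cod x -> chart_map (chart_inv x) = x;
  chart_map_cts : forall p, chart_dom p -> {for p, continuous chart_map};
  chart_inv_cts : forall x, chart_cod x -> {for x, continuous chart_inv}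
}.

Definition smooth_transition R n (M : topologicalType) (c d : chart R n M) :=
  forall i : 'I_n,
    smooth_on (chart_cod c `&` chart_inv c @^-1` chart_dom d)
              (fun x => chart_map d (chart_inv c x) 0 i).

Record manifold (R : realType) (n : nat) := Manifold {
  mfd_space :> topologicalType;
  mfd_hausdorff : hausdorff_space mfd_space;
  mfd_second_countable : @second_countable mfd_space;
  mfd_atlas : set (chart R n mfd_space);
  mfd_cover : forall p, exists2 c, mfd_atlas c & chart_dom c p;
  mfd_compat : forall c d, mfd_atlas c -> mfd_atlas d -> smooth_transition c d
}.

Section SmoothFun.
Context {R : realType} {n : nat} (M : manifold R n).

Definition smooth (f : M -> R) : Prop :=
  forall c, mfd_atlas c -> smooth_on (chart_cod c) (f \o chart_inv c).

Definition smooth_pred : {pred M -> R} := fun f => `[< smooth f >].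

Record smooth_fun := SmoothFun {
  smooth_fun_val :> M -> R;
  _ : smooth_fun_val \in smooth_pred }.

HB.instance Definition _ := [isSub for smooth_fun_val].
HB.instance Definition _ := [Choice of smooth_fun by <:].

Lemma smooth_cst (a : R) : smooth (fun=> a).
Proof. by move=> c _ k; apply: Ck_cst; exact: chart_open_cod. Qed.

Lemma smoothD f g : smooth f -> smooth g -> smooth (f + g).
Proof.
move=> sf sg c cM k; apply: (@CkD _ _ k _ (f \o chart_inv c) (g \o chart_inv c)).
- exact: chart_open_cod.
- exact: sf.
- exact: sg.
Qed.

Lemma smoothM f g : smooth f -> smooth g -> smooth (f * g).
Proof.
move=> sf sg c cM k; apply: (@CkM _ _ k _ (f \o chart_inv c) (g \o chart_inv c)).
- exact: chart_open_cod.
- exact: sf.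
- exact: sg.
Qed.

Lemma smooth_subring : subring_closed smooth_pred.
Proof.
split=> [|f g /asboolP sf /asboolP sg|f g /asboolP sf /asboolP sg].
- by apply/asboolP; exact: smooth_cst.
- apply/asboolP; apply: smoothD => //.
  rewrite (_ : - g = (fun=> -1) * g); first by apply: smoothM => //; exact: smooth_cst.
  by apply/funext => x; rewrite /GRing.mul /= mulN1r.
- by apply/asboolP; exact: smoothM.
Qed.

Lemma smooth_scale : GRing.scaler_closed smooth_pred.
Proof.
move=> a f /asboolP sf; apply/asboolP.
by rewrite (_ : a *: f = (fun=> a) * f)//; apply: smoothM => //; exact: smooth_cst.
Qed.

HB.instance Definition _ := GRing.isSubringClosed.Build (M -> R) smooth_pred
  smooth_subring.
HB.instance Definition _ := GRing.isScaleClosed.Build R (M -> R) smooth_pred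
  smooth_scale.
HB.instance Definition _ := 
  GRing.SubChoice_isSubComPzRing.Build (M -> R) smooth_pred smooth_fun smooth_subring.
HB.instance Definition _ := [SubZmodule_isSubLmodule of smooth_fun by <:].

Lemma smooth_funP (f g : smooth_fun) : f =1 g -> f = g.
Proof. by move=> fg; apply/val_inj/funext. Qed.

Lemma smooth_fun0 p : (0 : smooth_fun) p = 0. Proof. by []. Qed.

Lemma smooth_fun1 p : (1 : smooth_fun) p = 1. Proof. by []. Qed.

Lemma smooth_funD (f g : smooth_fun) p : (f + g) p = f p + g p.
Proof. by []. Qed.

Lemma smooth_funN (f : smooth_fun) p : (- f) p = - f p. Proof. by []. Qed.

Lemma smooth_funM (f g : smooth_fun) p : (f * g) p = f p * g p.
Proof. by []. Qed.

Lemma smooth_funZ (a : R) (f : smooth_fun) p : (a *: f) p = a * f p.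
Proof. by []. Qed.

Definition smooth_funE :=
  (smooth_fun0, smooth_fun1, smooth_funD, smooth_funN, smooth_funM, smooth_funZ).

End SmoothFun.

Section VectorFields.
Context {R : realType} {n : nat} (M : manifold R n).
Local Notation C := (smooth_fun M).

(* Vector fields are the derivations of the algebra C of smooth functions, and
   1-forms the C-linear maps from vector fields to C; both agree with sections
   of TM and T^*M because M is Hausdorff and second countable. *)
Definition derivation (X : C -> C) : Prop :=
  (forall (a : R) f g, X (a *: f + g) = a *: X f + X g) /\
  (forall f g, X (f * g) = X f * g + f * X g).

Definition derivation_pred : {pred C -> C^o} := fun X => `[< derivation X >].

(* C^o is C viewed as a module over itself, so that C -> C^o, and with it
   vector fields, is a module over C (not just over R). *)
Record vfield := VField {
  vfield_val : C -> C^o;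
  _ : vfield_val \in derivation_pred }.

HB.instance Definition _ := [isSub for vfield_val].
HB.instance Definition _ := [Choice of vfield by <:].

Definition vfield_app (X : vfield) (f : C) : C := vfield_val X f.
Coercion vfield_app : vfield >-> Funclass.

Lemma derivation_submod : submod_closed derivation_pred.
Proof.
split=> [|f X Y /asboolP[XD XM] /asboolP[YD YM]]; apply/asboolP; split.
- by move=> a g h; apply: smooth_funP => p; rewrite !smooth_funE mulr0 addr0.
- by move=> g h; apply: smooth_funP => p; rewrite !smooth_funE mul0r mulr0 addr0.
- move=> a g h; apply: smooth_funP => p.
  have -> : (f *: X + Y) (a *: g + h) = f * X (a *: g + h) + Y (a *: g + h) by [].
  rewrite XD YD.
  have -> : (f *: X + Y) g = f * X g + Y g by [].
  have -> : (f *: X + Y) h = f * X h + Y h by [].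
  by rewrite !smooth_funE; ring.
- move=> g h; apply: smooth_funP => p.
  have -> : (f *: X + Y) (g * h) = f * X (g * h) + Y (g * h) by [].
  rewrite XM YM.
  have -> : (f *: X + Y) g = f * X g + Y g by [].
  have -> : (f *: X + Y) h = f * X h + Y h by [].
  by rewrite !smooth_funE; ring.
Qed.

HB.instance Definition _ := GRing.isSubmodClosed.Build C (C -> C^o)
  derivation_pred derivation_submod.
HB.instance Definition _ := [SubChoice_isSubLmodule of vfield by <:].

Lemma vfieldP (X Y : vfield) : X =1 Y -> X = Y.
Proof. by move=> XY; apply/val_inj/funext. Qed.

Lemma vfieldZD (f : C) (X Y : vfield) (g : C) :
  (f *: X + Y) g = f * X g + Y g.
Proof. by []. Qed.

Lemma vfield_derivation (X : vfield) : derivation X.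
Proof. by apply/asboolP; exact: (valP X). Qed.

Definition bracket_fun (X Y : vfield) : C -> C^o := fun f => X (Y f) - Y (X f).

Lemma bracket_derivation (X Y : vfield) : bracket_fun X Y \in derivation_pred.
Proof.
have [XD XM] := vfield_derivation X; have [YD YM] := vfield_derivation Y.
have XDD f g : X (f + g) = X f + X g by rewrite -[f]scale1r XD !scale1r.
have YDD f g : Y (f + g) = Y f + Y g by rewrite -[f]scale1r YD !scale1r.
apply/asboolP; split=> [a f g|f g]; apply: smooth_funP => p; rewrite /bracket_fun.
  by rewrite XD YD XD YD !smooth_funE; ring.
by rewrite XM YM XDD YDD !XM !YM !smooth_funE; ring.
Qed.

Definition bracket (X Y : vfield) : vfield := VField (bracket_derivation X Y).

Definition oneform_pred : {pred vfield -> C^o} :=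
  fun alpha => `[< forall (f : C) (X Y : vfield),
    alpha (f *: X + Y) = f * alpha X + alpha Y >].

Record oneform := OneForm {
  oneform_val : vfield -> C^o;
  _ : oneform_val \in oneform_pred }.

HB.instance Definition _ := [isSub for oneform_val].
HB.instance Definition _ := [Choice of oneform by <:].

Definition oneform_app (alpha : oneform) (X : vfield) : C := oneform_val alpha X.
Coercion oneform_app : oneform >-> Funclass.

Lemma oneform_submod : submod_closed oneform_pred.
Proof.
split=> [|f a b /asboolP aP /asboolP bP]; apply/asboolP.
  by move=> f X Y; apply: smooth_funP => p; rewrite !smooth_funE mulr0 addr0.
move=> g X Y.
have -> Z : (f *: a + b) Z = f * a Z + b Z by [].
by rewrite aP bP; apply: smooth_funP => p; rewrite !smooth_funE; ring.
Qed.

HB.instance Definition _ := GRing.isSubmodClosed.Build C (vfield -> C^o)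
  oneform_pred oneform_submod.
HB.instance Definition _ := [SubChoice_isSubLmodule of oneform by <:].

Lemma oneform_linear (alpha : oneform) (f : C) (X Y : vfield) :
  alpha (f *: X + Y) = f * alpha X + alpha Y.
Proof. by move/asboolP: (valP alpha); apply. Qed.

End VectorFields.

Section Connections.
Context {R : realType} {n : nat} (M : manifold R n).
Local Notation C := (smooth_fun M).

(* R-linearity in the second argument follows from additivity and the Leibniz
   rule, since X kills the constants. *)
Record connection := Connection {
  conn :> vfield M -> vfield M -> vfield M;
  conn_linear : forall (f : C) X X' Y, conn (f *: X + X') Y = f *: conn X Y + conn X' Y;
  conn_additive : forall X Y Y', conn X (Y + Y') = conn X Y + conn X Y';
  conn_leibniz : forall (f : C) X Y, conn X (f *: Y) = X f *: Y + f *: conn X Y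
}.

Variable D : connection.

Definition conn_dual_fun (X : vfield M) (alpha : oneform M) : vfield M -> C^o :=
  fun Y => X (alpha Y) - alpha (D X Y).

Lemma conn_dual_linear X alpha : conn_dual_fun X alpha \in @oneform_pred R n M.
Proof.
have [XD XM] := vfield_derivation X.
have XDD f g : X (f + g) = X f + X g by rewrite -[f]scale1r XD !scale1r.
apply/asboolP => f Y Z; rewrite /conn_dual_fun.
rewrite conn_additive conn_leibniz -addrA !oneform_linear XDD XM.
by apply: smooth_funP => p; rewrite !smooth_funE; ring.
Qed.

Definition conn_dual X alpha : oneform M := OneForm (conn_dual_linear X alpha).

Definition curvature_dual (X Y : vfield M) (alpha : oneform M) : oneform M :=
  conn_dual X (conn_dual Y alpha) - conn_dual Y (conn_dual X alpha)
  - conn_dual (bracket X Y) alpha.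

End Connections.

Section Metrics.
Context {R : realType} {n : nat} (M : manifold R n).
Local Notation C := (smooth_fun M).

Definition constf (l : R) : C := l *: (1 : C).

(* metric_nondegenerate is nondegeneracy of each form g_p on the tangent space
   T_pM, whose elements are the values X_p : f |-> X f p of vector fields, and
   metric_onto says that the resulting map TM -> T^*M is onto on sections.  The
   latter follows from the former on every manifold, so it does not restrict
   the metrics considered. *)
Record metric := Metric {
  metric_form :> vfield M -> vfield M -> C;
  metric_linear : forall (f : C) X X' Y,
    metric_form (f *: X + X') Y = f * metric_form X Y + metric_form X' Y;
  metric_sym : forall X Y, metric_form X Y = metric_form Y X;
  metric_nondegenerate : forall (p : M) X,
    (forall Y, metric_form X Y p = 0) -> forall f : C, X f p = 0;
  metric_onto : forall alpha : oneform M,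
    exists X, forall Y, metric_form X Y = alpha Y
}.

(* The vector field written g^* alpha, unique by nondegeneracy; see sharpE. *)
Definition sharp (g : metric) (alpha : oneform M) : vfield M :=
  projT1 (cid (metric_onto g alpha)).

Lemma sharpE (g : metric) alpha Y : g (sharp g alpha) Y = alpha Y.
Proof. exact: (projT2 (cid (metric_onto g alpha))). Qed.

Definition cometric (g : metric) (alpha beta : oneform M) : C :=
  g (sharp g alpha) (sharp g beta).

Definition pencil_form (g gt : metric) (l : R) (alpha beta : oneform M) : C :=
  cometric g alpha beta + constf l * cometric gt alpha beta.

(* Nondegeneracy on each T^*_pM, whose elements are the values of 1-forms. *)
Definition coform_nondegenerate (h : oneform M -> oneform M -> C) : Prop :=
  forall (p : M) alpha, (forall beta, h alpha beta p = 0) ->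
    forall Y, alpha Y p = 0.

Definition levi_civita (g : metric) (D : connection M) : Prop :=
  (forall X Y : vfield M, D X Y - D Y X = bracket X Y) /\
  (forall X Y Z : vfield M, X (g Y Z) = g (D X Y) Z + g Y (D X Z)).

(* In the two definitions below, gl l is meant to be the metric whose
   cometric is pencil_form g gt l, and D, Dt, Dl l the Levi-Civita connections
   of g, gt, gl l. *)
Definition almost_compatible (g gt : metric) (gl : R -> metric)
    (D Dt : connection M) (Dl : R -> connection M) : Prop :=
  forall (X : vfield M) (alpha : oneform M) (l : R),
    sharp (gl l) (conn_dual (Dl l) X alpha) =
    sharp g (conn_dual D X alpha)
      + constf l *: sharp gt (conn_dual Dt X alpha).

Definition compatible (g gt : metric) (gl : R -> metric)
    (D Dt : connection M) (Dl : R -> connection M) : Prop :=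
  almost_compatible g gt gl D Dt Dl /\
  forall (alpha : oneform M) (X Y : vfield M) (l : R),
    sharp (gl l) (curvature_dual (Dl l) X Y alpha) =
    sharp g (curvature_dual D X Y alpha)
      + constf l *: sharp gt (curvature_dual Dt X Y alpha).

Definition circ (g : metric) (D Dt : connection M) (alpha beta : oneform M) :
    oneform M :=
  conn_dual D (sharp g alpha) beta - conn_dual Dt (sharp g alpha) beta.

End Metrics.

(* Main.v *)
From HB Require Import structures.
Require Import Defs.
From mathcomp Require Import all_boot all_order all_algebra.
From mathcomp Require Import all_classical all_reals all_analysis.
From mathcomp Require Import ring lra.

Set Implicit Arguments.
Unset Strict Implicit.
Unset Printing Implicit Defensive.

Import GRing.Theory.
Local Open Scope ring_scope.

(** Write s, st and sl for the musical isomorphisms of g, gt and gl l from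
    1-forms to vector fields.  The dual of gl l being the pencil, sl = s + l st.
    Everything is expressed through the tensor S = D - Dt acting on 1-forms, for
    which circ alpha beta = S (s alpha) beta.

    Torsion-freeness of D and Dt makes the bilinear form S_X alpha (Y) symmetric
    in X and Y ([diff_dualC]).  Torsion-freeness of one further member of the
    pencil makes the tensor T = st o s^-1 self-adjoint for this form
    ([diff_dual_selfadjoint]), which amounts to s (S_(TX) alpha) =
    st (S_X alpha) ([sharp_diff_dual]).  This gives the connection of the pencil
    explicitly: for X = sl xi it is Dt_X + S_(s xi) = D_X - l S_(st xi) on
    1-forms.  Using the first expression after Dt and the second one after D, the
    failure of the curvature to be affine along the pencil comes out, paired with
    a 1-form gamma and for X = sl xi, Y = sl eta, as
<<
      l (Q (sl xi) (st eta) - Q (sl eta) (st xi)),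
      where Q X Y = S_X gamma (s (S_Y alpha)) = g^* (S_X gamma, S_Y alpha)
>>
    ([pencil_curvature]).  On the other hand the identity
    (beta o gamma) o alpha = (beta o alpha) o gamma says exactly that every such
    Q is symmetric ([circ_circE]).

    As T is also self-adjoint for Q ([diff_form_selfadjoint]), symmetry of Q
    makes the defect vanish.  Conversely, the defect is a polynomial in l
    without constant term whose l^2 coefficient is
    Q (st xi) (st eta) - Q (st eta) (st xi); if it vanishes for all l, then Q is
    symmetric, since st is onto. *)

(** * Pairings and musical isomorphisms *)

Section Pairing.
Context {R : realType} {n : nat} (M : manifold R n).
Local Notation C := (smooth_fun M).
Implicit Types (X Y Z : vfield M) (alpha beta : oneform M) (f : C) (g : metric M).

Lemma oneformP alpha beta : (forall X, alpha X = beta X) -> alpha = beta.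
Proof. by move=> ab; apply/val_inj/funext. Qed.

Lemma oneform_addE alpha beta X : (alpha + beta) X = alpha X + beta X.
Proof. by []. Qed.

Lemma oneform_oppE alpha X : (- alpha) X = - alpha X.
Proof. by []. Qed.

Lemma oneform_scaleE f alpha X : (f *: alpha) X = f * alpha X.
Proof. by []. Qed.

Lemma oneformD alpha X Y : alpha (X + Y) = alpha X + alpha Y.
Proof. by rewrite -[X]scale1r oneform_linear mul1r scale1r. Qed.

Lemma oneform0 alpha : alpha 0 = 0.
Proof. by apply: (@addrI _ (alpha 0)); rewrite -oneformD !addr0. Qed.

Lemma oneformZ alpha f X : alpha (f *: X) = f * alpha X.
Proof. by rewrite -[f *: X]addr0 oneform_linear oneform0 addr0. Qed.

Lemma oneformN alpha X : alpha (- X) = - alpha X.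
Proof. by rewrite -scaleN1r oneformZ mulN1r. Qed.

Definition pairingE :=
  (oneform_addE, oneform_oppE, oneform_scaleE, oneformD, oneformN, oneformZ).

Lemma flat_oneform g X : (g X : vfield M -> C^o) \in @oneform_pred R n M.
Proof.
apply/asboolP => f Y Z.
by rewrite Defs.metric_sym metric_linear Defs.metric_sym [g Z X]Defs.metric_sym.
Qed.

Definition flat g X : oneform M := OneForm (flat_oneform g X).

Lemma sharp_pairC g alpha beta : alpha (sharp g beta) = beta (sharp g alpha).
Proof. by rewrite -(sharpE g alpha) Defs.metric_sym sharpE. Qed.

Lemma metric_inj g X Y : (forall Z, g X Z = g Y Z) -> X = Y.
Proof.
move=> gXY; apply/eqP; rewrite -subr_eq0; apply/eqP.
apply: vfieldP => f; apply: smooth_funP => p.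
apply: (@metric_nondegenerate _ _ _ g p) => Z.
by rewrite addrC -scaleN1r metric_linear gXY mulN1r addNr.
Qed.

(** The 1-forms [flat g Z] already separate vector fields, by non-degeneracy
    of g.  This turns equations between vector fields into equations between
    functions, where [ring] applies pointwise. *)
Lemma vfield_pairP g X Y : (forall alpha, alpha X = alpha Y) -> X = Y.
Proof.
move=> XY; apply: (@metric_inj g) => Z.
by rewrite Defs.metric_sym [RHS]Defs.metric_sym; exact: (XY (flat g Z)).
Qed.

Lemma sharp_inj g : injective (sharp g).
Proof. by move=> a b ab; apply: oneformP => X; rewrite -(sharpE g a) ab sharpE. Qed.

Lemma sharp_onto g X : exists alpha, sharp g alpha = X.
Proof. by exists (flat g X); apply: (@metric_inj g) => Z; rewrite sharpE. Qed.

Lemma sharpD g alpha beta : sharp g (alpha + beta) = sharp g alpha + sharp g beta.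
Proof.
apply: (@vfield_pairP g) => gamma.
by rewrite oneformD !(sharp_pairC g gamma).
Qed.

Lemma sharpZ g f alpha : sharp g (f *: alpha) = f *: sharp g alpha.
Proof.
apply: (@vfield_pairP g) => gamma.
by rewrite oneformZ !(sharp_pairC g gamma).
Qed.

Lemma sharpN g alpha : sharp g (- alpha) = - sharp g alpha.
Proof. by rewrite -scaleN1r sharpZ scaleN1r. Qed.

Definition sharpDNZ := (sharpD, sharpN, sharpZ).

End Pairing.

(** * Connections on 1-forms *)

Section Connections.
Context {R : realType} {n : nat} (M : manifold R n).
Local Notation C := (smooth_fun M).
Implicit Types (X Y Z : vfield M) (alpha beta : oneform M) (f : C) (l : R).
Implicit Types (D : connection M) (g : metric M).

Lemma vfieldD X f h : X (f + h) = X f + X h.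
Proof. by rewrite -[f]scale1r (proj1 (vfield_derivation X)) !scale1r. Qed.

Lemma vfield_constf X l : X (constf M l) = 0.
Proof.
have [XD XM] := vfield_derivation X.
have X0 : X 0 = 0 by apply: (@addrI _ (X 0)); rewrite -vfieldD !addr0.
have X1 : X 1 = 0.
  by apply: (@addrI _ (X 1)); rewrite addr0 -{3}[1]mulr1 XM mulr1 mul1r.
by rewrite -[constf M l]addr0 XD X0 X1 scaler0 addr0.
Qed.

Lemma vfieldN X f : X (- f) = - X f.
Proof.
apply: (@addrI _ (X f)); rewrite -vfieldD !subrr.
by apply: (@addrI _ (X 0)); rewrite -vfieldD !addr0.
Qed.

Lemma conn_dualE D X alpha Y : conn_dual D X alpha Y = X (alpha Y) - alpha (D X Y).
Proof. by []. Qed.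

Lemma conn_dualD D X alpha beta :
  conn_dual D X (alpha + beta) = conn_dual D X alpha + conn_dual D X beta.
Proof.
apply: oneformP => Y; apply: smooth_funP => p.
by rewrite !pairingE !conn_dualE !pairingE vfieldD !smooth_funE; ring.
Qed.

Lemma conn_dual_constf D X l alpha :
  conn_dual D X (constf M l *: alpha) = constf M l *: conn_dual D X alpha.
Proof.
apply: oneformP => Y; rewrite !pairingE !conn_dualE !pairingE.
by rewrite (proj2 (vfield_derivation X)) vfield_constf mul0r add0r mulrBr.
Qed.

Lemma conn_dualN D X alpha : conn_dual D X (- alpha) = - conn_dual D X alpha.
Proof.
apply: oneformP => Y; rewrite !pairingE !conn_dualE !pairingE vfieldN.
by rewrite opprD.
Qed.

(** Parallelism of g: differentiation commutes with raising the index. *)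
Lemma levi_civita_sharp g D X alpha : levi_civita g D ->
  D X (sharp g alpha) = sharp g (conn_dual D X alpha).
Proof.
move=> [_ Dg]; apply: (@metric_inj _ _ _ g) => Z.
rewrite sharpE conn_dualE -!(sharpE g) Dg.
by rewrite addrK.
Qed.

(** The antisymmetrised derivative is the exterior derivative, hence the same
    for all torsion-free connections. *)
Lemma conn_dual_torsion g D X Y alpha : levi_civita g D ->
  conn_dual D X alpha Y - conn_dual D Y alpha X =
  X (alpha Y) - Y (alpha X) - alpha (bracket X Y).
Proof.
move=> [<- _]; rewrite !conn_dualE !pairingE.
by apply: smooth_funP => p; rewrite !smooth_funE; ring.
Qed.

End Connections.

(** * The difference of the two connections *)

(** The tensor S = D - Dt on 1-forms.  It is locked so that rewriting with
    [pairingE] does not split it into its two terms. *)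
HB.lock Definition diff_dual (R : realType) (n : nat) (M : manifold R n)
    (D Dt : connection M) (X : vfield M) (alpha : oneform M) : oneform M :=
  conn_dual D X alpha - conn_dual Dt X alpha.

Section Pencil.
Context {R : realType} {n : nat} (M : manifold R n).
Local Notation C := (smooth_fun M).
Context (g gt : metric M) (gl : R -> metric M).
Context (gl_pencil : forall l alpha beta,
  cometric (gl l) alpha beta = pencil_form g gt l alpha beta).
Context (D Dt : connection M) (Dl : R -> connection M).
Context (D_lc : levi_civita g D) (Dt_lc : levi_civita gt Dt).
Context (Dl_lc : forall l, levi_civita (gl l) (Dl l)).
Context (ac : almost_compatible g gt gl D Dt Dl).
Implicit Types (X Y Z : vfield M) (alpha beta gamma xi eta : oneform M) (l : R).

Local Notation s := (sharp g).
Local Notation st := (sharp gt).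
Local Notation sl l := (sharp (gl l)).

Local Notation S := (diff_dual D Dt).

Lemma conn_dual_diff X alpha : conn_dual D X alpha = conn_dual Dt X alpha + S X alpha.
Proof. by rewrite diff_dual.unlock addrC subrK. Qed.

Lemma diff_dualE X alpha Y : S X alpha Y = alpha (Dt X Y) - alpha (D X Y).
Proof.
rewrite diff_dual.unlock !pairingE !conn_dualE.
by apply: smooth_funP => p; rewrite !smooth_funE; ring.
Qed.

Lemma diff_dualC X Y alpha : S X alpha Y = S Y alpha X.
Proof.
apply/eqP; rewrite -subr_eq0; apply/eqP.
transitivity ((conn_dual D X alpha Y - conn_dual D Y alpha X) -
             (conn_dual Dt X alpha Y - conn_dual Dt Y alpha X)).
  rewrite diff_dual.unlock !pairingE.
  by apply: smooth_funP => p; rewrite !smooth_funE; ring.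
by rewrite !(conn_dual_torsion _ _ _ D_lc) !(conn_dual_torsion _ _ _ Dt_lc) subrr.
Qed.

Lemma diff_dual_linearl (f : C) X Y alpha : S (f *: X + Y) alpha = f *: S X alpha + S Y alpha.
Proof.
apply: oneformP => Z.
by rewrite pairingE !pairingE !(diff_dualC _ Z) !pairingE.
Qed.

Lemma sharp_pencil l alpha : sl l alpha = s alpha + constf M l *: st alpha.
Proof.
apply: (@vfield_pairP _ _ _ g) => beta; rewrite !pairingE.
have := gl_pencil l alpha beta; rewrite /pencil_form /cometric !sharpE => e.
by rewrite !(sharp_pairC _ beta).
Qed.

Lemma diff_dual_pencil l xi alpha :
  S (sl l xi) alpha = S (s xi) alpha + constf M l *: S (st xi) alpha.
Proof. by rewrite sharp_pencil addrC diff_dual_linearl addrC. Qed.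

(** The 1-form (Dl 1)_X alpha, evaluated on [sl 1 eta], is by almost
    compatibility Dt_X alpha (sl 1 eta) + S_X alpha (s eta).  Put X = sl 1 xi and
    antisymmetrise in xi and eta: the exterior derivatives cancel, so
    S_(sl 1 xi) alpha (s eta) is symmetric in xi and eta.  Its part
    S_(s xi) alpha (s eta) is so by torsion-freeness of D and Dt, hence the
    remaining part S_(st xi) alpha (s eta) is as well. *)
Lemma diff_dual_selfadjoint xi eta alpha :
  S (st xi) alpha (s eta) = S (st eta) alpha (s xi).
Proof.
set c := constf M 1; have c1 : c = 1 by rewrite /c /constf scale1r.
have sl1 al : sl 1 al = s al + st al by rewrite sharp_pencil -/c c1 scale1r.
have e X be : conn_dual (Dl 1) X alpha (sl 1 be) =
    conn_dual Dt X alpha (sl 1 be) + S X alpha (s be).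
  rewrite (sharp_pairC (gl 1)) ac -/c c1 scale1r conn_dual_diff !sharpDNZ !pairingE.
  by rewrite -!(sharp_pairC _ be) sl1 !pairingE addrAC.
have := conn_dual_torsion (sl 1 xi) (sl 1 eta) alpha (Dl_lc 1).
rewrite -(conn_dual_torsion _ _ _ Dt_lc) !e opprD addrACA -[RHS]addr0.
move=> /addrI /eqP; rewrite subr_eq0 => /eqP.
rewrite !sl1 -[s xi]scale1r -[s eta]scale1r !diff_dual_linearl !scale1r !pairingE.
by rewrite (diff_dualC (s xi)) => /addrI.
Qed.

(** The self-adjointness of T = st o s^-1, freed of its second argument. *)
Lemma sharp_diff_dual xi alpha : s (S (st xi) alpha) = st (S (s xi) alpha).
Proof.
apply: (@vfield_pairP _ _ _ g) => eta.
rewrite (sharp_pairC g) diff_dual_selfadjoint (sharp_pairC gt).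
exact: diff_dualC.
Qed.

(** Almost compatibility defines Dl through the inverse of [sl l]; along
    vectors of the form [sl l xi] that inverse disappears. *)
Lemma pencil_conn_dual l xi alpha :
  conn_dual (Dl l) (sl l xi) alpha =
  conn_dual Dt (sl l xi) alpha + S (s xi) alpha.
Proof.
apply: (@sharp_inj _ _ _ (gl l)); rewrite ac conn_dual_diff diff_dual_pencil.
rewrite !(sharp_pencil l (_ + _)) !sharpDNZ sharp_diff_dual.
apply: (@vfield_pairP _ _ _ g) => gamma.
by rewrite !pairingE; apply: smooth_funP => p; rewrite !smooth_funE; ring.
Qed.

Lemma pencil_conn_dual' l xi alpha :
  conn_dual (Dl l) (sl l xi) alpha =
  conn_dual D (sl l xi) alpha - constf M l *: S (st xi) alpha.
Proof.
rewrite pencil_conn_dual conn_dual_diff diff_dual_pencil.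
by rewrite addrA addrK.
Qed.

(** * Curvature along the pencil *)

(** By almost compatibility the outer derivative is a D-part plus l times a
    Dt-part.  Expanding the inner one around D in the former and around Dt in the
    latter leaves -l D_X V + l Dt_X V with the same vector field
    V = s (S (st xi) alpha) = st (S (s xi) alpha), in which no derivative of S
    survives. *)
Lemma pencil_conn_dual2 l X xi alpha gamma :
  gamma (sl l (conn_dual (Dl l) X (conn_dual (Dl l) (sl l xi) alpha))) =
  gamma (s (conn_dual D X (conn_dual D (sl l xi) alpha))) +
  constf M l * gamma (st (conn_dual Dt X (conn_dual Dt (sl l xi) alpha))) +
  constf M l * S X gamma (s (S (st xi) alpha)).
Proof.
rewrite ac {1}pencil_conn_dual' pencil_conn_dual.
rewrite !(conn_dualD, conn_dualN, conn_dual_constf) !sharpDNZ.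
(* s is parallel for D and st for Dt; this exposes D_X V and Dt_X V. *)
rewrite -[s (conn_dual D X (S _ _))](levi_civita_sharp _ _ D_lc).
rewrite -[st (conn_dual Dt X (S _ _))](levi_civita_sharp _ _ Dt_lc).
rewrite -sharp_diff_dual !pairingE diff_dualE.
by apply: smooth_funP => p; rewrite !smooth_funE; ring.
Qed.

Lemma pencil_curvature l xi eta alpha gamma :
  gamma (sl l (curvature_dual (Dl l) (sl l xi) (sl l eta) alpha)) =
  gamma (s (curvature_dual D (sl l xi) (sl l eta) alpha)) +
  constf M l * gamma (st (curvature_dual Dt (sl l xi) (sl l eta) alpha)) +
  constf M l * (S (sl l xi) gamma (s (S (st eta) alpha)) -
                S (sl l eta) gamma (s (S (st xi) alpha))).
Proof.
rewrite /curvature_dual !sharpDNZ !pairingE !pencil_conn_dual2 ac !pairingE.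
by apply: smooth_funP => p; rewrite !smooth_funE; ring.
Qed.

(** * The bilinear forms behind the multiplication *)

(** The dual metric of g on the values of S: g^* (S_X gamma, S_Y alpha). *)
Definition diff_form alpha gamma X Y : C := S X gamma (s (S Y alpha)).

Lemma diff_formC alpha gamma X Y :
  diff_form alpha gamma X Y = diff_form gamma alpha Y X.
Proof. exact: sharp_pairC. Qed.

Lemma diff_form_selfadjoint alpha gamma xi eta :
  diff_form alpha gamma (st xi) (s eta) = diff_form alpha gamma (s xi) (st eta).
Proof.
rewrite /diff_form sharp_pairC sharp_diff_dual sharp_pairC.
by rewrite sharp_diff_dual.
Qed.

Lemma diff_form_sharp_pencil alpha gamma l xi Y :
  diff_form alpha gamma (sl l xi) Y =
  diff_form alpha gamma (s xi) Y + constf M l * diff_form alpha gamma (st xi) Y.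
Proof.
by rewrite /diff_form diff_dual_pencil !pairingE.
Qed.

Lemma circ_circE alpha beta gamma X :
  circ g D Dt (circ g D Dt beta gamma) alpha X = diff_form gamma alpha X (s beta).
Proof.
have circE a b : circ g D Dt a b = S (s a) b by rewrite diff_dual.unlock.
by rewrite !circE diff_dualC.
Qed.

(** The coefficients of l and l^2 in l Q (sl xi) (st eta), that is
    Q (s xi) (st eta) and Q (st xi) (st eta), are then both symmetric in xi and eta, the first by self-adjointness of T. *)
Lemma compatible_of_sym :
  (forall alpha gamma X Y, diff_form alpha gamma X Y = diff_form alpha gamma Y X) ->
  compatible g gt gl D Dt Dl.
Proof.
move=> sym; split=> // alpha X Y l.
have [xi <-] := sharp_onto (gl l) X; have [eta <-] := sharp_onto (gl l) Y.
apply: (@vfield_pairP _ _ _ g) => gamma; rewrite pencil_curvature !pairingE.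
rewrite -!/(diff_form _ _ _ _) !diff_form_sharp_pencil.
rewrite [diff_form _ _ (st xi) _]sym -(diff_form_selfadjoint _ _ xi) sym.
by rewrite subrr mulr0 addr0.
Qed.

Lemma sym_of_compatible : compatible g gt gl D Dt Dl ->
  forall alpha gamma X Y, diff_form alpha gamma X Y = diff_form alpha gamma Y X.
Proof.
move=> [_ comp] alpha gamma X Y.
have [xi <-] := sharp_onto gt X; have [eta <-] := sharp_onto gt Y.
have key l : constf M l * (diff_form alpha gamma (sl l xi) (st eta) -
    diff_form alpha gamma (sl l eta) (st xi)) = 0.
  apply: (@addrI _ (gamma (sl l (curvature_dual (Dl l) (sl l xi) (sl l eta) alpha)))).
  by rewrite addr0 {2}pencil_curvature comp !pairingE.
(* With l = 1 and l = -1 the terms of first order in l cancel, which leaves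
   twice the antisymmetric part of the form at (st xi, st eta). *)
have := key 1; have := key (-1); rewrite !diff_form_sharp_pencil.
move=> k1 k2; apply: smooth_funP => p.
have := congr1 (fun f : C => f p) k1; have := congr1 (fun f : C => f p) k2.
rewrite /constf !smooth_funE; lra.
Qed.

End Pencil.

Theorem proposition10 (R : realType) (n : nat) (M : manifold R n)
  (g gt : metric M)
  (pencil_nondegenerate :
     forall l : R, coform_nondegenerate (pencil_form g gt l))
  (gl : R -> metric M)
  (gl_pencil : forall (l : R) (alpha beta : oneform M),
     cometric (gl l) alpha beta = pencil_form g gt l alpha beta)
  (D Dt : connection M) (Dl : R -> connection M)
  (D_lc : levi_civita g D) (Dt_lc : levi_civita gt Dt)
  (Dl_lc : forall l : R, levi_civita (gl l) (Dl l))
  (ac : almost_compatible g gt gl D Dt Dl) :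
  compatible g gt gl D Dt Dl <->
  (forall alpha beta gamma : oneform M,
     circ g D Dt (circ g D Dt beta gamma) alpha =
     circ g D Dt (circ g D Dt beta alpha) gamma).
Proof.
split=> [comp alpha beta gamma|circ_sym].
  apply: oneformP => X; rewrite !(circ_circE D_lc Dt_lc) diff_formC.
  exact: (sym_of_compatible gl_pencil D_lc Dt_lc Dl_lc ac comp).
apply: (compatible_of_sym gl_pencil D_lc Dt_lc Dl_lc ac) => alpha gamma X Y.
have [beta <-] := sharp_onto g Y.
by rewrite -(circ_circE D_lc Dt_lc) circ_sym (circ_circE D_lc Dt_lc) diff_formC.
Qed.
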